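(* For a soft Multi-GM $(f_a)_{a\in\mathcal V}$ over a finite multi-graph $\mathcal G=(\mathcal V,\mathcal E)$ there exists a BP gauge $x$, i.e. a point $x\in\mathbb R_{+}^{\mathcal E_d}$ with all components positive satisfying $\partial_{x_\gamma}z(x)=0$ for all $\gamma\in\mathcal E_d$, such that $$Z^{(\mathrm{vbp})}=z(x),$$ where $z$ is the Gauge Function and $Z^{(\mathrm{vbp})}$ is the Variational BP estimate of the partition function.
   Context: $\mathcal G=(\mathcal V,\mathcal E)$ is a finite undirected multi-graph; multiple edges and self-edges are allowed. Each $\alpha\in\mathcal E$ has two directed versions, $\alpha_d$ and its reverse $\bar\alpha_d$; $\mathcal E_d$ is the set of all directed edges, and $u(\alpha_d)=u(\bar\alpha_d)=\alpha$. Each directed edge is attached to exactly one node: for an edge joining two distinct nodes one of its two directed versions is attached to each end node; for a self-edge both directed versions are attached to its node. $e_d(a)$ is the set of directed edges attached to node $a$, and $\Sigma_a=\{0,1\}^{e_d(a)}$. A Multi-GM is a collection of factors $f_a:\Sigma_a\to[0,\infty)$, $a\in\mathcal V$; it is soft if $f_a(s)>0$ for all $a$, $s$. Gauge Function: for $x=(x_\gamma)_{\gamma\in\mathcal E_d}$ with positive components, $x_a=(x_\gamma)_{\gamma\in e_d(a)}$, $$z(x)=\frac{\prod_{a\in\mathcal V}h_a(x_a)}{\prod_{\alpha\in\mathcal E}(1+x_{\alpha_d}x_{\bar\alpha_d})},\qquad h_a(x_a)=\sum_{s\in\Sigma_a}f_a(s)\prod_{\gamma\in e_d(a)}x_\gamma^{s_\gamma}.$$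 Variational BP estimate: let $\Pi$ be the polytope of $(b,\beta)$ with $b_a(s)\in[0,1]$ ($a\in\mathcal V$, $s\in\Sigma_a$), $\beta\in[0,1]^{\mathcal E}$, such that $\sum_{s\in\Sigma_a}b_a(s)=1$ for all $a$ and $\sum_{s\in\Sigma_a,\,s_\gamma=1}b_a(s)=\beta_{u(\gamma)}$ for all $a$ and $\gamma\in e_d(a)$. Then $-\log Z^{(\mathrm{vbp})}=\min_{(b,\beta)\in\Pi}F^{(bp)}(b,\beta)$ with (using $0\log0=0$) $$F^{(bp)}(b,\beta)=\sum_{a\in\mathcal V}\sum_{s\in\Sigma_a}b_a(s)\log\frac{b_a(s)}{f_a(s)}-\sum_{\alpha\in\mathcal E}\bigl(\beta_\alpha\log\beta_\alpha+(1-\beta_\alpha)\log(1-\beta_\alpha)\bigr).$$ *)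

(* Defs.v *)
From mathcomp Require Import all_boot all_order all_algebra.
From mathcomp Require Import all_classical all_reals all_analysis.

Set Implicit Arguments.
Unset Strict Implicit.
Unset Printing Implicit Defensive.

Import Order.TTheory GRing.Theory Num.Theory.
Import numFieldNormedType.Exports.

Local Open Scope classical_set_scope.
Local Open Scope ring_scope.

(* The two directed versions of the edge [e] are [(e, true)] and [(e, false)]
   (which is called which is immaterial), so the underlying-edge map is [fst].
   [attach] is unconstrained: [e] is a self-edge when its two directed versions
   are attached to the same node, and otherwise it joins the two distinct nodes
   to which they are attached.  Multiple edges are allowed. *)
Record multigraph := Multigraph {
  node : finType;
  edge : finType;
  attach : edge * bool -> node }.

Definition dedge (G : multigraph) : finType := (edge G * bool)%type.

Definition underlying (G : multigraph) (g : dedge G) : edge G := g.1.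

Definition attached (G : multigraph) (a : node G) : finType :=
  {g : dedge G | attach g == a}.

Definition Sigma (G : multigraph) (a : node G) : finType :=
  {ffun attached a -> bool}.

Record multiGM (R : realType) (G : multigraph) := MultiGM {
  factor :> forall a : node G, Sigma a -> R;
  factor_ge0 : forall (a : node G) (s : Sigma a), 0 <= factor s }.

Definition soft (R : realType) (G : multigraph) (f : multiGM R G) : Prop :=
  forall (a : node G) (s : Sigma a), 0 < f a s.

Section Gauge.
Variables (R : realType) (G : multigraph) (f : multiGM R G).

Definition gauge_factor (a : node G) (xa : attached a -> R) : R :=
  \sum_(s : Sigma a) f a s * \prod_(g : attached a) xa g ^+ s g.

Definition gauge_function (x : dedge G -> R) : R :=
  (\prod_(a : node G) gauge_factor (fun g : attached a => x (val g))) /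
  (\prod_(e : edge G) (1 + x (e, true) * x (e, false))).

(* [is_derive] asserts that the partial derivative exists and equals 0. *)
Definition BP_gauge (x : dedge G -> R) : Prop :=
  (forall g : dedge G, 0 < x g) /\
  (forall g : dedge G,
     is_derive (x g) (1 : R)
       (fun t : R => gauge_function [eta x with g |-> t]) 0).

End Gauge.

Section Variational.
Variables (R : realType) (G : multigraph) (f : multiGM R G).

Definition beliefs : Type :=
  ((forall a : node G, Sigma a -> R) * (edge G -> R))%type.

Definition BP_polytope : set beliefs := [set p : beliefs |
  [/\ forall (a : node G) (s : Sigma a), 0 <= p.1 a s <= 1,
      forall e : edge G, 0 <= p.2 e <= 1,
      forall a : node G, \sum_(s : Sigma a) p.1 a s = 1 &
      forall (a : node G) (g : attached a),
        \sum_(s : Sigma a | s g) p.1 a s = p.2 (underlying (val g))]].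

(* [0 log 0 = 0] holds automatically: [ln] is total and is multiplied by 0. *)
Definition BP_free_energy (p : beliefs) : R :=
  (\sum_(a : node G) \sum_(s : Sigma a) p.1 a s * ln (p.1 a s / f a s)) -
  (\sum_(e : edge G) (p.2 e * ln (p.2 e) + (1 - p.2 e) * ln (1 - p.2 e))).

Definition is_minimum (S : set R) (m : R) : Prop := S m /\ lbound S m.

(* [Z] is the variational BP estimate: [- ln Z] is the (attained) minimum.
   Positivity is needed since [ln] takes the value 0 on nonpositive reals. *)
Definition is_Zvbp (Z : R) : Prop :=
  0 < Z /\ is_minimum (BP_free_energy @` BP_polytope) (- ln Z).

Lemma is_Zvbp_unique (Z1 Z2 : R) : is_Zvbp Z1 -> is_Zvbp Z2 -> Z1 = Z2.
Proof.
move=> [Z1_gt0 [m1 lb1]] [Z2_gt0 [m2 lb2]].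
apply: ln_inj => //; apply: oppr_inj; apply/le_anti.
by rewrite (lb1 _ m2) (lb2 _ m1).
Qed.

End Variational.

(* Main.v *)
Require Import Defs.
From mathcomp Require Import all_boot all_order all_algebra.
From mathcomp Require Import all_classical all_reals all_analysis.
From mathcomp Require Import ring lra.

(* The free energy is continuous on the compact polytope, so it has a minimizer
   [(b, beta)]. The infinite slope of [x ln x] at [0] forces the minimizer into
   the interior: if [beta_e] is [0] or [1], flipping the bits of [e] gains
   [t ln t] at both ends of [e] and loses it once in the entropy of [e]; once
   all [beta_e] are in [(0, 1)], moving towards the product measure with the
   same marginals gains [t ln t] wherever [b_a(s) = 0]. In the interior, the
   first-order conditions say that [ln (b_a(s) / f_a(s))] is affine in the bits
   of [s], with slopes [ln x_g], and that the two slopes along an edge add up to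
   [ln (beta_e / (1 - beta_e))]. Hence [b_a(s) = f_a(s) prod_g x_g^(s_g) / h_a(x)]
   and [beta_e = x x' / (1 + x x')], so that [x] is a BP gauge and the minimal
   free energy is [- ln z(x)]. *)

Set Implicit Arguments.
Unset Strict Implicit.
Unset Printing Implicit Defensive.

Import Order.TTheory GRing.Theory Num.Theory.
Import numFieldNormedType.Exports.

Local Open Scope classical_set_scope.
Local Open Scope ring_scope.

(** * Continuity of [x ln x] and its one-sided slopes, including at [0] *)

Section XLnX.
Variable R : realType.
Implicit Types q e t x : R.

Definition xlnx x : R := x * ln x.

Lemma xlnx0 : xlnx 0 = 0.
Proof. by rewrite /xlnx mul0r. Qed.

(** With [s = sqrt x], [x ln x = 2 s (s ln s)], and [- s ln s < 1] because [ln (1/s) < 1/s]. This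
    bound squeezes [xlnx] to [0] at the origin. *)
Lemma norm_xlnx_le x : x <= 1 -> `|xlnx x| <= 2 * Num.sqrt `|x|.
Proof.
move=> x1; have [x0|x0] := leP x 0.
  by rewrite /xlnx ln0// mulr0 normr0 mulr_ge0// sqrtr_ge0.
rewrite (gtr0_norm x0) /xlnx normrM (gtr0_norm x0).
set s := Num.sqrt x.
have s0 : 0 < s by rewrite sqrtr_gt0.
have xE : x = s ^+ 2 by rewrite sqr_sqrtr// ltW.
have lnxE : ln x = ln s *+ 2 by rewrite xE lnXn.
rewrite ler0_norm ?ln_le0//.
have := ln_sublinear (x := s^-1); rewrite invr_gt0 => /(_ s0).
rewrite lnV// => lns.
have : s * - ln s < 1 by rewrite -ltr_pdivlMl// mulr1.
move=> h; rewrite lnxE xE expr2 mulr2n; nra.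
Qed.

Lemma continuous_xlnx : continuous xlnx.
Proof.
move=> x; have [x0|x0|->] := ltgtP x 0.
- apply: cvg_near_cst; near=> y.
  rewrite /xlnx !ln0 ?mulr0 ?ltW//.
  by near: y; exact: lt_nbhsl.
- by apply: cvgM => //; exact: continuous_ln.
- have lim0 : 2 * Num.sqrt `|y| @[y --> (0 : R)] --> (0 : R).
    suff : 2 * Num.sqrt `|y| @[y --> (0 : R)] --> 2 * Num.sqrt `|0 : R|.
      by rewrite normr0 sqrtr0 mulr0.
    apply: cvgMl_tmp; apply: (@continuous_cvg _ _ _ _ _ _ Num.sqrt).
      exact: sqrt_continuous.
    exact: norm_continuous.
  have cvg0 : `|xlnx y| @[y --> (0 : R)] --> (0 : R).
    apply: squeeze_cvgr (cvg_cst 0) lim0; near=> y.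
    rewrite normr_ge0 norm_xlnx_le// ltW//; near: y.
    by apply: lt_nbhsl; exact: ltr01.
  by rewrite /continuous_at xlnx0; exact/norm_cvg0P.
Unshelve. all: by end_near. Qed.

(** The finite part of the slope at [q] in direction [e]: for [q = 0] one has
    [xlnx (t * e) / t = e ln t + xlnx e], otherwise it is the ordinary derivative. *)
Definition xlnx_rate q e := if q == 0 then xlnx e else e * (1 + ln q).

(* The logarithmic term accounts for the infinite slope of [xlnx] at [0]. *)
Lemma xlnx_slope q e : 0 <= q -> (q = 0 -> 0 <= e) ->
  (xlnx (q + t * e) - xlnx q) / t - (q == 0)%:R * e * ln t @[t --> 0^'+] -->
  xlnx_rate q e.
Proof.
rewrite /xlnx_rate => q_ge0 e_ge0; have [q0|q_neq0] := eqVneq q 0.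
  apply: cvg_near_cst; near=> t.
  have t_gt0 : 0 < t by near: t; exact: nbhs_right_gt.
  rewrite q0 xlnx0 add0r subr0 mul1r /xlnx.
  have := e_ge0 q0; rewrite le_eqVlt => /predU1P[<-|e_gt0].
    by rewrite !(mulr0, mul0r) subrr.
  rewrite lnM//; field; exact: lt0r_neq0.
have q_gt0 : 0 < q by rewrite lt_neqAle eq_sym q_neq0.
have dx : is_derive (0 : R) 1 (fun t => xlnx (q + t * e)) (e * (1 + ln q)).
  rewrite /xlnx.
  have q0 : 0 < q + 0 * e by rewrite mul0r addr0.
  have dl : is_derive (0 : R) 1 (fun t => q + t * e) e.
    by apply: is_derive_eq; rewrite scaler0 !add0r mul1r /GRing.scale/= mulr1.
  have dln := is_derive1_ln q0.
  apply: is_derive_eq; rewrite !mul0r addr0 /GRing.scale/=; field.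
  exact: lt0r_neq0.
under eq_cvg do rewrite !mul0r subr0.
have : h^-1 *: (xlnx (q + (h *: 1 + 0) * e) - xlnx (q + 0 * e)) @[h --> (0 : R)^']
    --> e * (1 + ln q).
  have <- := @derive_val _ _ _ _ _ _ _ dx.
  exact: (@ex_derive _ _ _ _ _ _ _ dx).
move=> /cvg_dnbhs_at_right; apply: cvg_trans; apply: near_eq_cvg; near=> t.
by rewrite /GRing.scale/= mulr1 mul0r !addr0 mulrC.
Unshelve. all: by end_near. Qed.

(** Since [ln t] tends to minus infinity at [0], a positive [m] would drag the nonnegative quotient
    [u t / t] below [0]. For [m = 0] the quotient itself converges to [k]. *)
Lemma log_slope_ge0 (u : R -> R) (m k : R) :
  u t / t - m * ln t @[t --> 0^'+] --> k ->
  (\forall t \near 0^'+, 0 <= u t) ->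
  m <= 0 /\ (m = 0 -> 0 <= k).
Proof.
move=> uk u_ge0.
have q_ge0 : \forall t \near 0^'+, 0 <= u t / t.
  apply: filterS2 u_ge0 (nbhs_right_gt 0) => t ut t_gt0.
  by rewrite divr_ge0// ltW.
split.
  rewrite leNgt; apply/negP => m_gt0.
  suff : \forall t \near (0 : R)^'+, False by move=> /filter_ex[].
  near=> t.
  have ut : u t / t - m * ln t <= k + 1.
    by near: t; have /cvgr_le := uk; apply; rewrite ltrDl ltr01.
  (* This threshold makes [m * ln t < - (k + 1)], so that [u t / t] becomes negative. *)
  have lnt : ln t < - (k + 1) / m.
    by near: t; exact: (cvgrNy_lt (@lnNy R)).
  have : 0 <= u t / t by near: t.
  by move: lnt; rewrite ltr_pdivlMr// => lnt; nra.
move=> m0; apply: cvgr_to_ge uk _.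
by apply: filterS q_ge0 => t; rewrite m0 mul0r subr0.
Unshelve. all: by end_near. Qed.

Lemma cvg_sumr (T I : Type) (F : set_system T) (r : seq I) (P : pred I)
    (g : I -> T -> R) (l : I -> R) : Filter F ->
  (forall i, P i -> g i t @[t --> F] --> l i) ->
  \sum_(i <- r | P i) g i t @[t --> F] --> \sum_(i <- r | P i) l i.
Proof. by move=> FF; apply: cvg_big; exact: add_continuous. Qed.

End XLnX.

(** * First-order conditions along feasible directions of the polytope *)

Section FreeEnergy.
Variables (R : realType) (G : multigraph) (f : multiGM R G).
Hypothesis softf : soft f.
Implicit Types p d : beliefs R G.

Definition shift_beliefs p d (t : R) : beliefs R G :=
  (fun a s => p.1 a s + t * d.1 a s, fun e => p.2 e + t * d.2 e).

(** In this form every term is [xlnx] of an affine function of the beliefs, so continuity and slopes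
    reduce to those of [xlnx]. *)
Lemma free_energy_xlnx p :
  BP_free_energy f p =
  \sum_(a : node G) \sum_(s : Sigma a) f a s * xlnx (p.1 a s / f a s) -
  \sum_(e : edge G) (xlnx (p.2 e) + xlnx (1 - p.2 e)).
Proof.
congr (_ - _); apply: eq_bigr => a _; apply: eq_bigr => s _.
rewrite /xlnx mulrA [f a s * _]mulrC divfK//; exact/lt0r_neq0/softf.
Qed.

(** The coefficient of [ln t] in the slope of the free energy: only arguments of [xlnx] that vanish
    at [p] contribute, the entropy ones with a minus sign. *)
Definition log_rate p d : R :=
  \sum_(a : node G) \sum_(s : Sigma a) (p.1 a s == 0)%:R * d.1 a s -
  \sum_(e : edge G) ((p.2 e == 0)%:R * d.2 e - (p.2 e == 1)%:R * d.2 e).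

Definition energy_rate p d : R :=
  \sum_(a : node G) \sum_(s : Sigma a)
     f a s * xlnx_rate (p.1 a s / f a s) (d.1 a s / f a s) -
  \sum_(e : edge G) (xlnx_rate (p.2 e) (d.2 e) +
                     xlnx_rate (1 - p.2 e) (- d.2 e)).

Definition feasible p d : Prop :=
  [/\ forall a : node G, \sum_(s : Sigma a) d.1 a s = 0,
      forall (a : node G) (g : attached a),
        \sum_(s : Sigma a | s g) d.1 a s = d.2 (underlying (val g)) &
      forall (a : node G) (s : Sigma a), p.1 a s = 0 -> 0 <= d.1 a s].

Lemma marginal_le1 (a : node G) (b : Sigma a -> R) (P : pred (Sigma a)) :
  (forall s, 0 <= b s) -> \sum_s b s = 1 -> \sum_(s | P s) b s <= 1.
Proof.
move=> b0 <-; rewrite [leRHS](bigID P)/= lerDl.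
by apply: sumr_ge0 => s _.
Qed.

Lemma BP_polytopeP p :
  (forall (a : node G) (s : Sigma a), 0 <= p.1 a s) ->
  (forall a : node G, \sum_(s : Sigma a) p.1 a s = 1) ->
  (forall (a : node G) (g : attached a),
     \sum_(s : Sigma a | s g) p.1 a s = p.2 (underlying (val g))) ->
  @BP_polytope R G p.
Proof.
move=> p0 p1 pm; split=> //.
- move=> a s; rewrite p0/=.
  have := marginal_le1 (pred1 s) (p0 a) (p1 a).
  by rewrite big_pred1_eq.
- move=> e; have gP : attach (e, true) == attach (e, true) by [].
  have := pm _ (exist _ (e, true) gP : attached (attach (e, true))).
  rewrite /underlying/= => <-; rewrite sumr_ge0//=.
  exact: marginal_le1.
Qed.

(** The equalities are linear in [t]. A zero belief moves upwards, and a positive one stays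
    nonnegative for [t <= p / (1 + |d|)]; the [1] covers [d = 0]. *)
Lemma shift_feasible p d : BP_polytope p -> feasible p d ->
  \forall t \near (0 : R)^'+, @BP_polytope R G (shift_beliefs p d t).
Proof.
move=> [p0 _ p1 pm] [d1 dm d0].
have : \forall t \near (0 : R)^'+, forall (a : node G) (s : Sigma a),
    0 <= p.1 a s + t * d.1 a s.
  apply: filter_forall => a; apply: filter_forall => s.
  have [ps|ps] := eqVneq (p.1 a s) 0.
    apply: filterS (nbhs_right_gt 0) => t /ltW t_ge0.
    by rewrite ps add0r mulr_ge0//; exact: d0.
  have ps0 : 0 < p.1 a s by rewrite lt_neqAle eq_sym ps; case/andP: (p0 a s).
  near=> t; have t0 : 0 < t by near: t; exact: nbhs_right_gt.
  have : t <= p.1 a s / (1 + `|d.1 a s|).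
    by near: t; apply: nbhs_right_ltW; rewrite divr_gt0// ltr_pwDl.
  rewrite ler_pdivlMr ?ltr_pwDl// => h.
  have := lerNnormlW (lexx `|d.1 a s|); nra.
apply: filterS => t pt; apply: BP_polytopeP => //=.
- by move=> a; rewrite big_split/= p1 -mulr_sumr d1 mulr0 addr0.
- by move=> a g; rewrite big_split/= pm -mulr_sumr dm.
Unshelve. all: by end_near. Qed.

Lemma edge_attached (e : edge G) (b : bool) :
  exists g : attached (attach (e, b)), val g = (e, b).
Proof. by exists (exist _ (e, b) (eqxx _)). Qed.

(** Both [beta_e] and [1 - beta_e] are sums of beliefs at an end of [e]. If such a sum is [0], all
    its terms vanish, and [d] is nonnegative on each of them. *)
Lemma feasible_edge p d (e : edge G) : BP_polytope p -> feasible p d ->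
  (p.2 e = 0 -> 0 <= d.2 e) /\ (1 - p.2 e = 0 -> 0 <= - d.2 e).
Proof.
move=> [p0 _ p1 pm] [d1 dm d0].
have p_ge0 a s : 0 <= p.1 a s by case/andP: (p0 a s).
have [g ge] := edge_attached e true.
have <- : underlying (val g) = e by rewrite ge.
rewrite -dm -pm; split.
  move=> /psumr_eq0P ps0; apply: sumr_ge0 => s sg.
  by apply/d0/ps0.
rewrite -(p1 (attach (e, true))) [X in X - _](bigID (fun s : Sigma _ => s g))/=.
rewrite addrAC subrr add0r.
move=> /psumr_eq0P ps0.
have /eqP := d1 (attach (e, true)); rewrite (bigID (fun s : Sigma _ => s g))/=.
rewrite addr_eq0 => /eqP ->; rewrite opprK; apply: sumr_ge0 => s sg.
by apply/d0/ps0.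
Qed.

Lemma free_energy_slope p d : BP_polytope p -> feasible p d ->
  (BP_free_energy f (shift_beliefs p d t) - BP_free_energy f p) / t -
    log_rate p d * ln t @[t --> 0^'+] --> energy_rate p d.
Proof.
move=> pP dP; have [p0 p01 _ _] := pP; have [_ _ d0] := dP.
have f_neq0 (a : node G) (s : Sigma a) : f a s != 0.
  exact/lt0r_neq0/softf.
pose term (q e t : R) := (xlnx (q + t * e) - xlnx q) / t - (q == 0)%:R * e * ln t.
have termP q e : 0 <= q -> (q = 0 -> 0 <= e) ->
    term q e t @[t --> 0^'+] --> xlnx_rate q e.
  exact: xlnx_slope.
(* The logarithmic correction is distributed over the summands, each of which then converges by
   itself. *)
have -> : (fun t => (BP_free_energy f (shift_beliefs p d t) -
      BP_free_energy f p) / t - log_rate p d * ln t) =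
    (fun t => \sum_(a : node G) \sum_(s : Sigma a)
        f a s * term (p.1 a s / f a s) (d.1 a s / f a s) t -
      \sum_(e : edge G) (term (p.2 e) (d.2 e) t +
                         term (1 - p.2 e) (- d.2 e) t)).
  apply/funext => t; rewrite !free_energy_xlnx /log_rate/=.
  have -> : \sum_(a : node G) \sum_(s : Sigma a)
        f a s * term (p.1 a s / f a s) (d.1 a s / f a s) t =
      (\sum_(a : node G) \sum_(s : Sigma a)
         f a s * xlnx ((p.1 a s + t * d.1 a s) / f a s) -
       \sum_(a : node G) \sum_(s : Sigma a) f a s * xlnx (p.1 a s / f a s)) / t -
      (\sum_(a : node G) \sum_(s : Sigma a) (p.1 a s == 0)%:R * d.1 a s) * ln t.
    rewrite -sumrB !mulr_suml -sumrB; apply: eq_bigr => a _.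
    rewrite -sumrB !mulr_suml -sumrB; apply: eq_bigr => s _.
    rewrite /term mulf_eq0 invr_eq0 (negbTE (f_neq0 a s)) orbF/=.
    rewrite mulrA -mulrDl; set u := xlnx (_ / _); set v := xlnx (_ / _).
    rewrite [RHS](_ : _ = (u - v) * f a s / t -
      (p.1 a s == 0)%:R * (d.1 a s / f a s * f a s) * ln t); first by ring.
    by rewrite divfK//; ring.
  have -> : \sum_(e : edge G) (term (p.2 e) (d.2 e) t +
        term (1 - p.2 e) (- d.2 e) t) =
      (\sum_(e : edge G) (xlnx (p.2 e + t * d.2 e) +
         xlnx (1 - (p.2 e + t * d.2 e))) -
       \sum_(e : edge G) (xlnx (p.2 e) + xlnx (1 - p.2 e))) / t -
      (\sum_(e : edge G) ((p.2 e == 0)%:R * d.2 e - (p.2 e == 1)%:R * d.2 e)) *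
        ln t.
    rewrite -sumrB !mulr_suml -sumrB; apply: eq_bigr => e _.
    have -> : 1 - (p.2 e + t * d.2 e) = 1 - p.2 e + t * - d.2 e by ring.
    by rewrite /term subr_eq0 [1 == _]eq_sym; ring.
  by ring.
apply: cvgB; apply: cvg_sumr => i _.
  apply: cvg_sumr => s _; apply: cvgMl_tmp; apply: termP.
    by have /andP[? _] := p0 i s; rewrite divr_ge0// ltW.
  move=> /eqP; rewrite mulf_eq0 invr_eq0 (negbTE (f_neq0 i s)) orbF => /eqP.
  by move=> /d0 di; rewrite divr_ge0// ltW.
have /andP[i0 i1] := p01 i; have [di0 di1] := feasible_edge i pP dP.
by apply: cvgD; apply: termP => //; rewrite subr_ge0.
Qed.

Lemma first_order p d : BP_polytope p ->
  lbound (BP_free_energy f @` @BP_polytope R G) (BP_free_energy f p) ->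
  feasible p d ->
  log_rate p d <= 0 /\ (log_rate p d = 0 -> 0 <= energy_rate p d).
Proof.
move=> pP pmin dP; apply: log_slope_ge0 (free_energy_slope pP dP) _.
apply: filterS (shift_feasible pP dP) => t tP.
by rewrite subr_ge0; apply: pmin; exists (shift_beliefs p d t).
Qed.

End FreeEnergy.

(** * Product measures as points of the polytope *)

Section ProductBeliefs.
Variables (R : realType) (G : multigraph).

Lemma sum_prod_ffun_bool (T : finType) (F : T -> bool -> R) :
  \sum_(s : {ffun T -> bool}) \prod_(g : T) F g (s g) =
  \prod_(g : T) (F g true + F g false).
Proof.
by rewrite -bigA_distr_bigA; apply: eq_bigr => g _; rewrite big_bool.
Qed.

Definition bernoulli_weight (q : R) (b : bool) : R := if b then q else 1 - q.

Definition product_beliefs (beta : edge G -> R) : beliefs R G :=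
  (fun (a : node G) (s : Sigma a) =>
     \prod_(g : attached a) bernoulli_weight (beta (underlying (val g))) (s g),
   beta).

Lemma product_beliefs_gt0 (beta : edge G -> R) (a : node G) (s : Sigma a) :
  (forall e, 0 < beta e < 1) -> 0 < (product_beliefs beta).1 a s.
Proof.
move=> betaP; apply: prodr_gt0 => g _; rewrite /bernoulli_weight.
by have /andP[? ?] := betaP (underlying (val g)); case: ifP => _ //; rewrite subr_gt0.
Qed.

Lemma product_beliefs_polytope (beta : edge G -> R) :
  (forall e, 0 < beta e < 1) -> BP_polytope (product_beliefs beta).
Proof.
move=> betaP; apply: BP_polytopeP => [a s|a|a g] /=.
- exact/ltW/product_beliefs_gt0.
- rewrite (sum_prod_ffun_bool (fun g : attached a =>
    bernoulli_weight (beta (underlying (val g))))) big1// => g _.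
  by rewrite /bernoulli_weight subrKC.
- set F := fun h : attached a => bernoulli_weight (beta (underlying (val h))).
  (* [F'] annihilates the states whose bit at [g] is [0]; the restricted sum becomes a full one and
     factors over the bits. *)
  pose F' h b := if (h == g) && ~~ b then 0 else F h b.
  rewrite big_mkcond/= [LHS](_ : _ = \sum_(s : Sigma a) \prod_h F' h (s h)).
    rewrite (sum_prod_ffun_bool F') (bigD1 g)//= big1 => [|h hg].
      by rewrite /F'/= eqxx/= mulr1 addr0.
    by rewrite /F' (negbTE hg)/= /F /bernoulli_weight subrKC.
  apply: eq_bigr => s _; case: ifPn => sg.
    apply: eq_bigr => h _; rewrite /F'; case: eqP => //= ->.
    by rewrite sg.
  by rewrite [RHS](bigD1 g)//= /F' eqxx sg mul0r.
Qed.

End ProductBeliefs.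

(** * Existence of a minimizer by compactness *)

Lemma continuous_sumr (R : realType) (T : topologicalType) (I : Type)
    (r : seq I) (P : pred I) (g : I -> T -> R) :
  (forall i, continuous (g i)) ->
  continuous (fun t => \sum_(i <- r | P i) g i t).
Proof. by move=> cg; apply: continuous_big => //; exact: add_continuous. Qed.

Section RealContinuous.
Variables (R : realType) (T : topologicalType).
Implicit Types g h : T -> R.

Lemma continuousDr g h : continuous g -> continuous h ->
  continuous (fun t => g t + h t).
Proof. by move=> cg ch t; exact: (cvgD (cg t) (ch t)). Qed.

Lemma continuousBr g h : continuous g -> continuous h ->
  continuous (fun t => g t - h t).
Proof. by move=> cg ch t; exact: (cvgB (cg t) (ch t)). Qed.

Lemma continuousMlr c g : continuous g -> continuous (fun t => c * g t).
Proof. by move=> cg t; exact: (cvgMl_tmp (cg t)). Qed.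

Lemma continuousMrr c g : continuous g -> continuous (fun t => g t * c).
Proof. by move=> cg t; exact: (cvgMr_tmp (cg t)). Qed.

End RealContinuous.

Section Minimizer.
Variables (R : realType) (G : multigraph) (f : multiGM R G).
Hypothesis softf : soft f.

(** One coordinate per node and state and one per edge: beliefs become row vectors, for which closed
    boxes are compact. *)
Let coord : finType := ({a : node G & Sigma a} + edge G)%type.

Let decode (v : 'rV[R]_#|coord|) : beliefs R G :=
  (fun a s => v ord0 (enum_rank (inl (Tagged (@Sigma G) s) : coord)),
   fun e => v ord0 (enum_rank (inr e : coord))).

Let decode_surj (p : beliefs R G) : exists v, decode v = p.
Proof.
pose c (j : coord) := match j with
  | inl u => p.1 (tag u) (tagged u) | inr e => p.2 e end.
exists (\row_i c (enum_val i)); case: p @c => b beta c.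
rewrite /decode; congr pair; last by apply/funext => e; rewrite mxE enum_rankK.
by apply/functional_extensionality_dep => a; apply/funext => s; rewrite mxE enum_rankK.
Qed.

Let continuous_decode1 (a : node G) (s : Sigma a) :
  continuous (fun v => (decode v).1 a s).
Proof. exact: coord_continuous. Qed.

Let continuous_decode2 (e : edge G) : continuous (fun v => (decode v).2 e).
Proof. exact: coord_continuous. Qed.

Let continuous_free_energy : continuous (fun v => BP_free_energy f (decode v)).
Proof.
under eq_fun do rewrite (free_energy_xlnx softf).
have cphi (g : 'rV[R]_#|coord| -> R) : continuous g ->
    continuous (fun v => xlnx (g v)).
  by move=> cg v; apply: continuous_comp; [exact: cg|exact: continuous_xlnx].
apply: continuousBr; apply: continuous_sumr => i.
  apply: continuous_sumr => s; apply: continuousMlr; apply: cphi.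
  apply: continuousMrr; exact: continuous_decode1.
apply: continuousDr; apply: cphi; first exact: continuous_decode2.
apply: continuousBr; last exact: continuous_decode2.
exact: cst_continuous.
Qed.

Let closed_forall (T : topologicalType) (I : Type) (P : I -> set T) :
  (forall i, closed (P i)) -> closed [set v | forall i, P i v].
Proof.
move=> cP; rewrite [X in closed X](_ : _ = \bigcap_(i in setT) P i).
  by apply: closed_bigI => i _.
by apply/seteqP; split => v /= Pv i; [move=> _|]; exact: Pv.
Qed.

(** The polytope lies in the unit cube, and it is cut out by closed conditions on finite sums of
    coordinates. *)
Let compact_polytope : compact [set v | BP_polytope (decode v)].
Proof.
have box : compact [set v : 'rV[R]_#|coord| | forall i, `[(0 : R), 1]%classic (v ord0 i)].
  by apply: (@rV_compact _ _ (fun=> _)) => _; exact: segment_compact.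
apply: (subclosed_compact _ box).
  pose h (a : node G) (s : Sigma a) v := (decode v).1 a s.
  pose n a v := \sum_s h a s v.
  pose m a (g : attached a) v :=
    \sum_(s : Sigma a | s g) h a s v - (decode v).2 (underlying (val g)).
  rewrite [X in closed X](_ : _ =
    [set v | forall a s, (h a s @^-1` [set x | 0 <= x]) v] `&`
    [set v | forall a, (n a @^-1` [set x | x = 1]) v] `&`
    [set v | forall a g, (m a g @^-1` [set x | x = 0]) v]).
    apply: closedI; first apply: closedI.
    - apply: closed_forall => a; apply: closed_forall => s.
      apply: (@preimage_closed _ _ (h a s) [set x | 0 <= x]); last exact: closed_ge.
      by move=> v _; exact: continuous_decode1.
    - apply: closed_forall => a.
      apply: (@preimage_closed _ _ (n a) [set x | x = 1]); last exact: closed_eq.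
      by move=> v _; apply: continuous_sumr => s; exact: continuous_decode1.
    - apply: closed_forall => a; apply: closed_forall => g.
      apply: (@preimage_closed _ _ (m a g) [set x | x = 0]); last exact: closed_eq.
      move=> v _; apply: continuousBr; last exact: continuous_decode2.
      by apply: continuous_sumr => s; exact: continuous_decode1.
  apply/seteqP; split => v.
    move=> [p0 _ p1 pm]; split; first split => //=.
    - by move=> a s; case/andP: (p0 a s).
    - by move=> a g; apply/eqP; rewrite subr_eq0 pm.
  move=> [[p0 p1] pm]; apply: BP_polytopeP => // a g.
  by apply/eqP; rewrite -subr_eq0; apply/eqP/pm.
move=> v [p0 p01 _ _] i /=; rewrite in_itv/=.
rewrite -(enum_valK i); case: (enum_val i) => [[a s]|e]; first exact: p0.
exact: p01.
Qed.

Lemma free_energy_min : exists2 p, @BP_polytope R G p &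
  lbound (BP_free_energy f @` @BP_polytope R G) (BP_free_energy f p).
Proof.
(* Independent fair bits show that the polytope is nonempty. *)
have [v0 v0P] := decode_surj (product_beliefs (fun=> 2^-1)).
have [||v] := @compact_EVT_min _ R (fun v => BP_free_energy f (decode v)) _ _
    compact_polytope.
- exists v0; rewrite /= v0P; apply: product_beliefs_polytope => _.
  by rewrite invr_gt0 ltr0n/= invf_lt1// ltr1n.
- exact/continuous_subspaceT/continuous_free_energy.
rewrite inE => vP vmin; exists (decode v) => // _ [p pP <-].
have [w wE] := decode_surj p; rewrite -wE.
by apply: vmin; rewrite inE /= wE.
Qed.

End Minimizer.

(** * Minimizers lie in the interior of the polytope *)

Section Interior.
Variables (R : realType) (G : multigraph) (f : multiGM R G).
Hypothesis softf : soft f.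
Implicit Types (p d : beliefs R G) (a : node G) (e : edge G).

(** Both sides run once over all directed edges, grouped by node or by edge. A self-edge contributes
    both of its versions at one node, so it is no special case. *)
Lemma sum_attached (F : dedge G -> R) :
  \sum_(a : node G) \sum_(g : attached a) F (val g) =
  \sum_(e : edge G) (F (e, true) + F (e, false)).
Proof.
transitivity (\sum_(g : dedge G) F g).
  rewrite [RHS](partition_big (@attach G) predT)//=; apply: eq_bigr => a _.
  rewrite [RHS](reindex_omap (val : attached a -> dedge G) insub)/=.
    by apply: eq_big => [g|//]; rewrite valK eqxx andbT; exact/esym/(valP g).
  by move=> g ga; rewrite insubT.
rewrite (eq_bigr (fun g => F (g.1, g.2))); last by case.
rewrite -(pair_bigA _ (fun e b => F (e, b)))/=.
by apply: eq_bigr => e _; rewrite big_bool.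
Qed.

Definition flip a (g : attached a) (s : Sigma a) : Sigma a :=
  [ffun h => (h == g) (+) s h].

Lemma flipK a (g : attached a) : involutive (flip g).
Proof. by move=> s; apply/ffunP => h; rewrite !ffunE addKb. Qed.

Lemma flip_self a (g : attached a) (s : Sigma a) : flip g s g = ~~ s g.
Proof. by rewrite ffunE eqxx. Qed.

Lemma flip_other a (g h : attached a) (s : Sigma a) : h != g -> flip g s h = s h.
Proof. by move=> /negbTE hg; rewrite ffunE hg. Qed.

Lemma sum_flip a (g : attached a) (P : pred (Sigma a)) (b : Sigma a -> R) :
  \sum_(s | P s) b (flip g s) = \sum_(s | P (flip g s)) b s.
Proof.
rewrite (reindex_inj (inv_inj (flipK g)))/=.
by apply: eq_bigr => s _; rewrite flipK.
Qed.

Lemma marginalC p a (g : attached a) : BP_polytope p ->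
  \sum_(s : Sigma a | ~~ s g) p.1 a s = 1 - p.2 (underlying (val g)).
Proof.
move=> [_ _ p1 pm]; rewrite -(p1 a) -pm [X in _ = X - _](bigID (fun s : Sigma a => s g))/=.
by rewrite addrAC subrr add0r.
Qed.

(** All states of nonzero belief share the same bit at [g], so flipping that bit leaves the
    support. *)
Lemma extreme_marginal p a (g : attached a) (s : Sigma a) : BP_polytope p ->
  (p.2 (underlying (val g)) == 0) || (p.2 (underlying (val g)) == 1) ->
  p.1 a s != 0 -> p.1 a (flip g s) = 0.
Proof.
move=> pP; have [p0 _ p1 pm] := pP.
have p_ge0 r : 0 <= p.1 a r by case/andP: (p0 a r).
case/orP => /eqP gE.
  have z (r : Sigma a) : r g -> p.1 a r = 0.
    by move: r; apply: psumr_eq0P => [r _|]; rewrite ?pm.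
  by move=> s_neq0; apply: (z); rewrite flip_self; apply: contra s_neq0 => /z ->.
have z (r : Sigma a) : ~~ r g -> p.1 a r = 0.
  by move: r; apply: psumr_eq0P => [r _|]; rewrite ?marginalC// gE subrr.
by move=> s_neq0; apply: (z); rewrite flip_self negbK; apply: contraR s_neq0 => /z ->.
Qed.

Variables (p : beliefs R G) (pP : BP_polytope p)
  (pmin : lbound (BP_free_energy f @` @BP_polytope R G) (BP_free_energy f p)).

Lemma minimizer_edge e : 0 < p.2 e < 1.
Proof.
have [p0 p01 p1 pm] := pP.
have /andP[e0 e1] := p01 e.
rewrite !lt_neqAle e0 e1 !andbT -negb_or eq_sym; apply/negP => ext.
(* Each end of [e] exchanges the beliefs of a state and of its flip there, so the marginal changes
   at rate [(1 - beta_e) - beta_e]. Flips at other directed edges preserve it. *)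
pose d : beliefs R G :=
  (fun (a : node G) (s : Sigma a) =>
     \sum_(g : attached a | underlying (val g) == e)
        (p.1 a (flip g s) - p.1 a s),
   fun e' => (e' == e)%:R * (1 - 2 * p.2 e)).
have dP : feasible p d.
  split => [a|a h|a s ps] /=.
  - rewrite exchange_big/= big1// => g _.
    by rewrite sumrB (sum_flip g predT) subrr.
  - rewrite exchange_big/=.
    have other g : g != h ->
        \sum_(s : Sigma a | s h) (p.1 a (flip g s) - p.1 a s) = 0.
      move=> gh; rewrite sumrB (sum_flip g (fun s : Sigma a => s h)).
      by under eq_bigl do rewrite flip_other 1?eq_sym//; rewrite subrr.
    have [he|he] := eqVneq (underlying (val h)) e; last first.
      rewrite mul0r big1// => g /eqP ge; apply: other.
      by apply: contraNneq he => <-; rewrite ge.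
    rewrite (bigD1 h) ?he//= [X in _ + X]big1 => [|g /andP[_ gh]]; last exact: other.
    rewrite sumrB (sum_flip h (fun s : Sigma a => s h)).
    under eq_bigl do rewrite flip_self.
    by rewrite (marginalC h pP) pm he; ring.
  - apply: sumr_ge0 => g _; rewrite ps subr0.
    by case/andP: (p0 a (flip g s)).
have [+ _] := first_order softf pP pmin dP.
rewrite leNgt => /negP; apply.
rewrite /log_rate/=.
(* Flips of the support fall on states of belief [0], so each of the two versions of [e] contributes
   the whole mass [1]. *)
have -> : \sum_(a : node G) \sum_(s : Sigma a) (p.1 a s == 0)%:R *
   \sum_(g : attached a | underlying (val g) == e) (p.1 a (flip g s) - p.1 a s) = 2.
  transitivity (\sum_(a : node G) \sum_(g : attached a)
      (underlying (val g) == e)%:R : R).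
    apply: eq_bigr => a _; under eq_bigr do rewrite mulr_sumr.
    rewrite exchange_big/= [LHS]big_mkcond; apply: eq_bigr => g _.
    case: eqP => [ge|//].
    transitivity (\sum_s p.1 a (flip g s)); last first.
      by rewrite (sum_flip g predT) p1.
    apply: eq_bigr => s _; have [ps|ps] := eqVneq (p.1 a s) 0.
      by rewrite ps mul1r subr0.
    by rewrite mul0r (extreme_marginal pP _ ps)// ge.
  rewrite (sum_attached (fun g => (underlying g == e)%:R)) (bigD1 e)//= eqxx.
  by rewrite big1 ?addr0// => e' /negbTE ->; rewrite addr0.
rewrite (bigD1 e)//= big1 => [|e' /negbTE ->]; last by rewrite !mul0r !mulr0 subrr.
(* For [beta_e = 0] and for [beta_e = 1] alike the entropy takes away [1], which leaves
   [log_rate = 2 - 1 > 0]. *)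
rewrite eqxx; case/orP: ext => /eqP ->.
  by rewrite eqxx eq_sym oner_eq0/=; lra.
by rewrite eqxx oner_eq0/=; lra.
Qed.

Lemma minimizer_gt0 a (s : Sigma a) : 0 < p.1 a s.
Proof.
have [p0 p01 p1 pm] := pP.
have p_ge0 b r : 0 <= p.1 b r by case/andP: (p0 b r).
rewrite lt_neqAle p_ge0 andbT eq_sym; apply/negP => /eqP ps.
have qP := product_beliefs_polytope minimizer_edge.
have q_gt0 b (r : Sigma b) := product_beliefs_gt0 r minimizer_edge.
set q := product_beliefs p.2 in qP q_gt0; have [_ _ q1 qm] := qP.
(* The marginals agree, so the edge component is [0] and the entropy cannot offset the gain at a
   vanishing belief. *)
pose d : beliefs R G :=
  (fun (b : node G) (r : Sigma b) => q.1 b r - p.1 b r, fun=> 0).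
have dP : feasible p d.
  split => [b|b h|b r br] /=.
  - by rewrite sumrB q1 p1 subrr.
  - by rewrite sumrB qm pm subrr.
  - by rewrite br subr0; exact/ltW/q_gt0.
have [+ _] := first_order softf pP pmin dP.
rewrite leNgt => /negP; apply.
rewrite /log_rate/= [X in _ - X]big1 ?subr0 => [|e _]; last by rewrite !mulr0 subrr.
have ge0 b r : 0 <= (p.1 b r == 0)%:R * (q.1 b r - p.1 b r).
  by have [->|_] := eqVneq (p.1 b r) 0; rewrite ?mul0r// mul1r subr0; exact/ltW/q_gt0.
rewrite (bigD1 a)//= (bigD1 s)//= ps eqxx mul1r subr0 -addrA ltr_pwDl ?q_gt0//.
by rewrite addr_ge0 ?sumr_ge0// => b _; rewrite sumr_ge0.
Qed.

Let L a (s : Sigma a) := ln (p.1 a s / f a s).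
Let logit e := ln (p.2 e) - ln (1 - p.2 e).

(** No argument of [xlnx] vanishes, so [log_rate] is [0] and the ordinary derivatives remain. The
    [1] in [1 + ln q] cancels: at a node because [d] has total mass [0], at an edge because [beta_e]
    and [1 - beta_e] move oppositely. *)
Lemma interior_first_order d :
  (forall a, \sum_(s : Sigma a) d.1 a s = 0) ->
  (forall a (g : attached a),
     \sum_(s : Sigma a | s g) d.1 a s = d.2 (underlying (val g))) ->
  0 <= \sum_(a : node G) \sum_(s : Sigma a) d.1 a s * L s -
       \sum_(e : edge G) d.2 e * logit e.
Proof.
move=> d1 dm.
have dP : feasible p d.
  by split=> // a s /eqP; rewrite gt_eqF// minimizer_gt0.
have [_] := first_order softf pP pmin dP.
have -> : log_rate p d = 0.
  rewrite /log_rate [X in X - _]big1 ?sub0r => [|a _]; last first.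
    by rewrite big1// => s _; rewrite gt_eqF ?mul0r// minimizer_gt0.
  rewrite big1 ?oppr0// => e _; have /andP[e0 e1] := minimizer_edge e.
  by rewrite gt_eqF// lt_eqF// !mul0r subrr.
move=> /(_ erefl); congr (_ <= _); congr (_ - _).
  apply: eq_bigr => a _.
  transitivity (\sum_(s : Sigma a) (d.1 a s + d.1 a s * L s)).
    apply: eq_bigr => s _; have fs := softf s; have ps := minimizer_gt0 s.
    rewrite /xlnx_rate gt_eqF ?divr_gt0// mulrA [f a s * _]mulrC divfK ?gt_eqF//.
    by rewrite mulrDr mulr1.
  by rewrite big_split/= d1 add0r.
apply: eq_bigr => e _; have /andP[e0 e1] := minimizer_edge e.
by rewrite /xlnx_rate gt_eqF// gt_eqF ?subr_gt0// /logit; ring.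
Qed.

End Interior.

(** * Stationarity: log-affine beliefs and the relation along each edge *)

Section Stationary.
Variables (R : realType) (G : multigraph) (f : multiGM R G).
Hypothesis softf : soft f.
Variables (p : beliefs R G) (pP : BP_polytope p)
  (pmin : lbound (BP_free_energy f @` @BP_polytope R G) (BP_free_energy f p)).
Implicit Types (d : beliefs R G) (a : node G) (e : edge G).

Definition zero_state a : Sigma a := [ffun=> false].
Definition unit_state a (g : attached a) : Sigma a := [ffun h => h == g].

Definition log_ratio a (s : Sigma a) := ln (p.1 a s / f a s).
Definition log_odds e := ln (p.2 e) - ln (1 - p.2 e).
(** The slope of [log_ratio] in the bit [g], read off between the zero state and a unit state; its
    exponential will be the gauge. *)
Definition log_gauge (g : dedge G) : R :=
  let h : attached (attach g) := exist _ g (eqxx _) in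
  log_ratio (unit_state h) - log_ratio (zero_state (attach g)).

Lemma log_gaugeE a (g : attached a) :
  log_gauge (val g) = log_ratio (unit_state g) - log_ratio (zero_state a).
Proof.
case: g => g ga /=; have ag := eqP ga; subst a.
by rewrite /log_gauge (bool_irrelevance ga (eqxx _)).
Qed.

Lemma sum_pred1 a (phi : Sigma a -> R) (r : Sigma a) :
  \sum_(s : Sigma a) phi s * (s == r)%:R = phi r.
Proof.
rewrite (bigD1 r)//= eqxx mulr1 big1 ?addr0// => s /negbTE ->.
by rewrite mulr0.
Qed.

Lemma sum_bit a (h : attached a) (phi : Sigma a -> R) :
  \sum_(s : Sigma a | s h) phi s = \sum_(s : Sigma a) (s h)%:R * phi s.
Proof.
by rewrite big_mkcond; apply: eq_bigr => s _; case: (s h); rewrite ?mul1r ?mul0r.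
Qed.

(** The gap between [phi] and the affine function of the bits that interpolates it at the zero state
    and the unit states. *)
Definition affine_defect a (phi : Sigma a -> R) (r : Sigma a) : R :=
  phi r - \sum_(g : attached a) (r g)%:R * (phi (unit_state g) - phi (zero_state a)) -
  phi (zero_state a).

Lemma affine_defect1 a (r : Sigma a) : affine_defect (fun=> 1) r = 0.
Proof.
rewrite /affine_defect big1 => [|g _]; last by rewrite subrr mulr0.
by rewrite subr0 subrr.
Qed.

Lemma affine_defect_bit a (h : attached a) (r : Sigma a) :
  affine_defect (fun s => (s h)%:R) r = 0.
Proof.
rewrite /affine_defect (bigD1 h)//= big1 => [|g gh].
  by rewrite !ffunE eqxx !subr0 mulr1 addr0 subrr.
by rewrite !ffunE eq_sym (negbTE gh) subr0 mulr0.
Qed.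

(* Moving the belief of node [a] against its own affine defect preserves all
   marginals, so the first-order condition bounds a sum of squares by [0]. *)
Lemma log_ratio_affine a (s : Sigma a) :
  log_ratio s = log_ratio (zero_state a) +
    \sum_(g : attached a) (s g)%:R * log_gauge (val g).
Proof.
pose D a (r : Sigma a) := affine_defect (@log_ratio a) r.
(* The signed measure [u a r] represents the functional sending [phi] to [affine_defect phi r]. *)
pose u a (r s : Sigma a) : R := (s == r)%:R -
  \sum_(g : attached a) (r g)%:R * ((s == unit_state g)%:R - (s == zero_state a)%:R) -
  (s == zero_state a)%:R.
have uE b (phi : Sigma b -> R) r : \sum_s phi s * u b r s = affine_defect phi r.
  rewrite /u /affine_defect; under eq_bigr do rewrite !mulrBr mulr_sumr.
  rewrite !sumrB !sum_pred1 exchange_big/=; congr (_ - _ - _).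
  apply: eq_bigr => g _; under eq_bigr do rewrite mulrCA mulrBr.
  by rewrite -mulr_sumr sumrB !sum_pred1.
pose d : beliefs R G :=
  (fun b (t : Sigma b) => - \sum_r D b r * u b r t, fun=> 0).
have dE b (phi : Sigma b -> R) :
    \sum_t phi t * d.1 b t = - \sum_r D b r * affine_defect phi r.
  rewrite /=; under eq_bigr do rewrite mulrN mulr_sumr.
  rewrite sumrN exchange_big/=; congr (- _); apply: eq_bigr => r _.
  by under eq_bigr do rewrite mulrCA; rewrite -mulr_sumr uE.
have := @interior_first_order _ _ _ softf _ pP pmin d.
have -> : \sum_b \sum_t d.1 b t * ln (p.1 b t / f b t) =
    - \sum_b \sum_r D b r ^+ 2.
  rewrite -sumrN; apply: eq_bigr => b _; under eq_bigr do rewrite mulrC.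
  by rewrite (dE b (@log_ratio b)); congr (- _); apply: eq_bigr => r _; rewrite expr2.
rewrite [X in _ - X]big1 ?subr0 => [|e _]; last by rewrite mul0r.
(* Total mass and marginals pair [d] with constants and single bits, whose affine defects vanish. *)
have h1 b : \sum_t d.1 b t = 0.
  under eq_bigr => t _ do rewrite -[d.1 b t]mul1r.
  rewrite (dE b (fun=> 1)) big1 ?oppr0// => r _.
  by rewrite affine_defect1 mulr0.
have h2 b (h : attached b) : \sum_(t : Sigma b | t h) d.1 b t = 0.
  rewrite sum_bit (dE b (fun t : Sigma b => (t h)%:R)) big1 ?oppr0// => r _.
  by rewrite affine_defect_bit mulr0.
move=> /(_ h1 h2); rewrite oppr_ge0 => le0.
have D2_ge0 b : 0 <= \sum_r D b r ^+ 2 by apply: sumr_ge0 => r _; exact: sqr_ge0.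
have Dab : \sum_r D a r ^+ 2 = 0.
  apply: (@psumr_eq0P _ _ predT (fun b => \sum_r D b r ^+ 2)) => //.
  by apply/le_anti; rewrite le0 sumr_ge0.
have /eqP : D a s ^+ 2 = 0.
  by apply: (@psumr_eq0P _ _ predT (fun r => D a r ^+ 2)) => // r _; exact: sqr_ge0.
rewrite sqrf_eq0 /D /affine_defect subr_eq0 subr_eq => /eqP ->.
by congr (_ + _); apply: eq_bigr => g _; rewrite log_gaugeE.
Qed.

Lemma log_gauge_edge e :
  log_gauge (e, true) + log_gauge (e, false) = log_odds e.
Proof.
pose D e := log_gauge (e, true) + log_gauge (e, false) - log_odds e.
(* Mass moves from unit states to the zero state at rate [D e] at both ends of [e]. The first-order
   condition then reads [0 <= - sum_e (D e)^2]. *)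
pose d : beliefs R G :=
  (fun b (t : Sigma b) => - \sum_(g : attached b) D (underlying (val g)) *
      ((t == unit_state g)%:R - (t == zero_state b)%:R), fun e => - D e).
have dE b (phi : Sigma b -> R) :
    \sum_t phi t * d.1 b t = - \sum_(g : attached b) D (underlying (val g)) *
      (phi (unit_state g) - phi (zero_state b)).
  rewrite /=; under eq_bigr do rewrite mulrN mulr_sumr.
  rewrite sumrN exchange_big/=; congr (- _); apply: eq_bigr => g _.
  under eq_bigr do rewrite mulrCA mulrBr.
  by rewrite -mulr_sumr sumrB !sum_pred1.
have := @interior_first_order _ _ _ softf _ pP pmin d.
have -> : \sum_b \sum_t d.1 b t * ln (p.1 b t / f b t) =
    - \sum_e D e * (log_gauge (e, true) + log_gauge (e, false)).
  transitivity (- \sum_b \sum_(g : attached b)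
      D (underlying (val g)) * log_gauge (val g)).
    rewrite -sumrN; apply: eq_bigr => b _; under eq_bigr do rewrite mulrC.
    rewrite (dE b (@log_ratio b)); congr (- _); apply: eq_bigr => g _.
    by rewrite log_gaugeE.
  rewrite (sum_attached (fun g => D (underlying g) * log_gauge g)).
  by congr (- _); apply: eq_bigr => e' _; rewrite -mulrDr.
have h1 b : \sum_t d.1 b t = 0.
  under eq_bigr => t _ do rewrite -[d.1 b t]mul1r.
  by rewrite (dE b (fun=> 1)) big1 ?oppr0// => g _; rewrite subrr mulr0.
have h2 b (h : attached b) :
    \sum_(t : Sigma b | t h) d.1 b t = d.2 (underlying (val h)).
  rewrite sum_bit (dE b (fun t : Sigma b => (t h)%:R)) (bigD1 h)//= big1.
    by rewrite !ffunE eqxx subr0 mulr1 addr0.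
  by move=> g gh; rewrite !ffunE eq_sym (negbTE gh) subrr mulr0.
move=> /(_ h1 h2).
have -> : \sum_e d.2 e * (ln (p.2 e) - ln (1 - p.2 e)) =
    - \sum_e D e * log_odds e.
  by rewrite -sumrN; apply: eq_bigr => e' _; rewrite mulNr.
rewrite opprK addrC subr_ge0 -subr_le0 -sumrB => le0.
have /eqP : D e ^+ 2 = 0.
  apply: (@psumr_eq0P _ _ predT (fun e => D e ^+ 2)) => // [e' _|].
    exact: sqr_ge0.
  apply/le_anti/andP; split; last by apply: sumr_ge0 => e' _; exact: sqr_ge0.
  apply: le_trans le0; apply: ler_sum => e' _.
  by rewrite -mulrBr expr2.
by rewrite sqrf_eq0 subr_eq0 => /eqP.
Qed.

End Stationary.

(** * Partial derivatives of the gauge function *)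

Section GaugeDerivative.
Variables (R : realType) (G : multigraph) (f : multiGM R G).
Implicit Types (x : dedge G -> R) (a : node G).

Definition mate (g : dedge G) : dedge G := (g.1, ~~ g.2).

Lemma edge_weightE x (g : dedge G) :
  1 + x (g.1, true) * x (g.1, false) = 1 + x g * x (mate g).
Proof. by case: g => e [] //=; rewrite mulrC. Qed.

(** [gauge_factor] is affine in the variable [x (val h)]; these are its two coefficients, free of
    that variable. *)
Definition partial_factor x a (h : attached a) (b : bool) : R :=
  \sum_(s : Sigma a | s h == b)
    f a s * \prod_(g : attached a | g != h) x (val g) ^+ s g.

Lemma partial_factorE x a (h : attached a) (b : bool) :
  \sum_(s : Sigma a | s h == b)
    f a s * \prod_(g : attached a) x (val g) ^+ s g =
  x (val h) ^+ b * partial_factor x h b.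
Proof.
rewrite mulr_sumr; apply: eq_bigr => s /eqP sh.
by rewrite (bigD1 h)//= sh mulrCA.
Qed.

Lemma gauge_factor_split x a (h : attached a) :
  gauge_factor f (fun g : attached a => x (val g)) =
  partial_factor x h false + x (val h) * partial_factor x h true.
Proof.
rewrite -[X in X + _]mul1r -(partial_factorE x h false) -(partial_factorE x h true).
rewrite /gauge_factor (bigID (fun s : Sigma a => s h == false))/=; congr (_ + _).
by apply: eq_bigl => s; case: (s h).
Qed.

(* As a function of [x g] alone, [z] is [(A + B t) / (1 + t x')] up to a
   constant factor: under [B = A x'] it is constant. *)
Lemma gauge_function_derive x (g : dedge G) (h : attached (attach g)) :
  val h = g -> (forall k, 0 < x k) ->
  partial_factor x h true = partial_factor x h false * x (mate g) ->
  is_derive (x g) (1 : R)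
    (fun t : R => gauge_function f [eta x with g |-> t]) 0.
Proof.
move=> hg x_gt0 pf.
pose N := \prod_(a | a != attach g) gauge_factor f (fun k : attached a => x (val k)).
pose M := \prod_(e | e != g.1) (1 + x (e, true) * x (e, false)).
pose A := partial_factor x h false.
apply: (@near_eq_is_derive _ _ _ (cst (A * N / M) : R -> R)).
near=> t.
(* Positivity of [t] keeps [1 + t * x (mate g)] nonzero, so that it can be cancelled. *)
have t_gt0 : 0 < t by near: t; exact: lt_nbhsr.
set x' := [eta x with g |-> t].
have x'g : x' g = t by rewrite /x' /= eqxx.
have x'other k : k != g -> x' k = x k by move=> /negbTE kg; rewrite /x' /= kg.
move: x' x'g x'other => x' x'g x'other.
rewrite /gauge_function (bigD1 (attach g))//= [X in _ = _ / X](bigD1 g.1)//=.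
rewrite edge_weightE (gauge_factor_split x' h).
have mg : mate g != g by rewrite -pair_eqE /= andbC; case: g.2.
have pf' b : partial_factor x' h b = partial_factor x h b.
  apply: eq_bigr => s _; congr (_ * _); apply: eq_bigr => k kh.
  rewrite x'other//; apply: contra_neq kh => kg.
  by apply: val_inj; rewrite hg.
rewrite !pf' pf hg x'g (x'other _ mg) -/A.
have -> : \prod_(a | a != attach g) gauge_factor f (fun k : attached a => x' (val k)) = N.
  apply: eq_bigr => a ag; congr (gauge_factor f _); apply/funext => k.
  by rewrite x'other//; apply: contraNneq ag => <-; rewrite eq_sym (valP k).
have -> : \prod_(e | e != g.1) (1 + x' (e, true) * x' (e, false)) = M.
  by apply: eq_bigr => e eg; rewrite !x'other// -pair_eqE /= negb_and eg.
have xm := x_gt0 (mate g).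
have M0 : M != 0.
  by apply/lt0r_neq0/prodr_gt0 => e _; rewrite addr_gt0 ?mulr_gt0.
have w0 : 1 + t * x (mate g) != 0 by rewrite lt0r_neq0// addr_gt0 ?mulr_gt0.
by field; rewrite M0 w0.
Unshelve. all: by end_near. Qed.

End GaugeDerivative.

(** * The gauge of a minimizer and its value *)

Section MinimizerGauge.
Variables (R : realType) (G : multigraph) (f : multiGM R G).
Hypothesis softf : soft f.
Variables (p : beliefs R G) (pP : BP_polytope p)
  (pmin : lbound (BP_free_energy f @` @BP_polytope R G) (BP_free_energy f p)).
Implicit Types (a : node G) (e : edge G).

Definition minimizer_gauge (g : dedge G) : R := expR (log_gauge f p g).
Local Notation x := minimizer_gauge.
Local Notation L0 a := (log_ratio f p (zero_state a)).

Lemma minimizer_beliefsE a (s : Sigma a) :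
  p.1 a s = expR (L0 a) * (f a s * \prod_(g : attached a) x (val g) ^+ s g).
Proof.
have fs := softf s; have ps := minimizer_gt0 softf pP pmin s.
have -> : p.1 a s = f a s * expR (log_ratio f p s).
  by rewrite /log_ratio lnK ?posrE ?divr_gt0// mulrC divfK// gt_eqF.
rewrite (log_ratio_affine softf pP pmin) expRD expR_sum mulrCA.
congr (_ * (_ * _)); apply: eq_bigr => g _.
by rewrite expRM_natl.
Qed.

(** Normalization of the beliefs in their exponential form determines [h_a]. *)
Lemma minimizer_gauge_factor a :
  gauge_factor f (fun g : attached a => x (val g)) = expR (- L0 a).
Proof.
have [_ _ p1 _] := pP; have := p1 a.
under eq_bigr do rewrite minimizer_beliefsE.
rewrite -mulr_sumr => sum1; apply: (mulfI (lt0r_neq0 (expR_gt0 (L0 a)))).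
by rewrite -expRD subrr expR0.
Qed.

Lemma minimizer_gauge_edge e :
  x (e, true) * x (e, false) = p.2 e / (1 - p.2 e).
Proof.
have /andP[e0 e1] := minimizer_edge softf pP pmin e.
rewrite -expRD (log_gauge_edge softf pP pmin) /log_odds.
by rewrite expRD expRN !lnK// posrE subr_gt0.
Qed.

Lemma minimizer_partial_factorE a (h : attached a) (b : bool) :
  \sum_(s : Sigma a | s h == b) p.1 a s =
  expR (L0 a) * (x (val h) ^+ b * partial_factor f x h b).
Proof.
rewrite -partial_factorE mulr_sumr; apply: eq_bigr => s _.
exact: minimizer_beliefsE.
Qed.

(** Up to the factor [expR (L0 a)], the coefficients are [beta_e / x_h] and [1 - beta_e], while the
    product of [x] over the two versions of [e] is the odds [beta_e / (1 - beta_e)]. *)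
Lemma minimizer_partial_factor a (h : attached a) :
  partial_factor f x h true = partial_factor f x h false * x (mate (val h)).
Proof.
have [_ _ _ pm] := pP.
set e := underlying (val h).
have /andP[e0 e1] := minimizer_edge softf pP pmin e.
have xx : x (val h) * x (mate (val h)) = p.2 e / (1 - p.2 e).
  rewrite -minimizer_gauge_edge /e /underlying.
  by case: (val h) => e' [] //=; rewrite mulrC.
have B : p.2 e = expR (L0 a) * (x (val h) * partial_factor f x h true).
  rewrite -pm -(minimizer_partial_factorE h true).
  by apply: eq_bigl => s; rewrite eqb_id.
have A : 1 - p.2 e = expR (L0 a) * partial_factor f x h false.
  rewrite -(marginalC h pP) -[partial_factor _ _ _ _]mul1r.
  rewrite -(minimizer_partial_factorE h false).
  by apply: eq_bigl => s; rewrite eqbF_neg.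
have nz : expR (L0 a) * x (val h) != 0 by rewrite lt0r_neq0// mulr_gt0 ?expR_gt0.
apply: (mulfI nz); rewrite -mulrA -B.
transitivity ((1 - p.2 e) * (p.2 e / (1 - p.2 e))).
  by field; rewrite gt_eqF// subr_gt0.
by rewrite -xx A; ring.
Qed.

Lemma minimizer_gauge_BP : BP_gauge f x.
Proof.
split=> g; first exact: expR_gt0.
pose h : attached (attach g) := exist _ g (eqxx _).
apply: (@gauge_function_derive _ _ _ _ _ h) => //.
  by move=> k; exact: expR_gt0.
exact: minimizer_partial_factor.
Qed.

Lemma minimizer_gauge_function :
  gauge_function f x = expR (- BP_free_energy f p).
Proof.
have [_ _ p1 pm] := pP.
have -> : BP_free_energy f p =
    \sum_(a : node G) L0 a - \sum_(e : edge G) ln (1 - p.2 e).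
  rewrite /BP_free_energy.
  (* The affine form of [log_ratio] turns the node terms into [beta_e] times the log odds; against
     the entropy only [- ln (1 - beta_e)] survives. *)
  have -> : \sum_a \sum_s p.1 a s * ln (p.1 a s / f a s) =
      \sum_a L0 a + \sum_e p.2 e * log_odds p e.
    transitivity (\sum_a L0 a + \sum_a \sum_(g : attached a)
        p.2 (underlying (val g)) * log_gauge f p (val g)).
      rewrite -big_split/=; apply: eq_bigr => a _.
      under eq_bigr do rewrite -/(log_ratio _ _ _)
        (log_ratio_affine softf pP pmin) mulrDr mulr_sumr.
      rewrite big_split/= -mulr_suml p1 mul1r exchange_big/=; congr (_ + _).
      apply: eq_bigr => g _; rewrite -pm sum_bit mulr_suml.
      by apply: eq_bigr => s _; rewrite mulrA [p.1 a s * _]mulrC.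
    rewrite (sum_attached (fun g => p.2 (underlying g) * log_gauge f p g)).
    congr (_ + _); apply: eq_bigr => e _.
    by rewrite -mulrDr (log_gauge_edge softf pP pmin).
  rewrite -addrA -sumrB -sumrN; congr (_ + _); apply: eq_bigr => e _.
  by rewrite /log_odds; ring.
rewrite opprB addrC expRD -sumrN !expR_sum /gauge_function; congr (_ * _).
  by apply: eq_bigr => a _; exact: minimizer_gauge_factor.
rewrite -prodfV; apply: eq_bigr => e _.
have /andP[e0 e1] := minimizer_edge softf pP pmin e.
have e1' : 0 < 1 - p.2 e by rewrite subr_gt0.
rewrite minimizer_gauge_edge lnK ?posrE//.
(* The edge weight is [1 + beta_e / (1 - beta_e) = 1 / (1 - beta_e)]. *)
by rewrite -[X in X + _](divff (lt0r_neq0 e1')) -mulrDl subrK div1r invrK.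
Qed.

End MinimizerGauge.

Theorem mainTheorem6 (R : realType) (G : multigraph) (f : multiGM R G)
    (softf : soft f) :
  exists x : dedge G -> R, BP_gauge f x /\ is_Zvbp f (gauge_function f x).
Proof.
have [p pP pmin] := free_energy_min softf.
exists (minimizer_gauge f p); split; first exact: minimizer_gauge_BP.
rewrite (minimizer_gauge_function softf pP pmin); split; first exact: expR_gt0.
by rewrite expRK opprK; split=> //; exists p.
Qed.
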